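(* For any odd integer $d\geq 3$, $$1+\sum_{n=1}^{\infty} Z_n(\mathbb{C}^d)\,q^n\Big|_{\lambda_1+\cdots+\lambda_d=0}=M_{d-1}(-q)$$ (in particular the specialization of each $Z_n(\mathbb{C}^d)$ to $\lambda_1+\cdots+\lambda_d=0$ is well-defined).
   Context: An $n$-partition is a family $\pi=\{\pi_{i_1\ldots i_n}\}_{i_1,\ldots,i_n\geq 1}$ of non-negative integers with $\pi_{i_1\ldots i_n}\geq\pi_{j_1\ldots j_n}$ whenever $i_a\leq j_a$ for all $a$, and with finite size $|\pi|:=\sum\pi_{i_1\ldots i_n}<\infty$. Put $M_n(q):=\sum_{n\text{-partitions }\pi}q^{|\pi|}$. $(\mathbb{C}^* )^d$ acts on $\mathbb{C}^d$ in the standard way, the coordinate function $x_i$ having character $t_i$; $\lambda_i$ is the equivariant first Chern class of the character $t_i$. $\mathrm{Hilb}^n(\mathbb{C}^d)$ is the Hilbert scheme of $n$ points; its $(\mathbb{C}^* )^d$-fixed locus consists of finitely many reduced points, the length-$n$ subschemes $Z$ cut out by monomial ideals, which correspond to $(d-1)$-partitions of size $n$. $I_Z$ is the ideal sheaf of $Z$ and $\mathrm{Ext}^i(I_Z,I_Z)_0$ is the trace-free part (kernel of the trace map to $H^i(\mathcal{O}_{\mathbb{C}^d})$). $\mathrm{Ext}^{\mathrm{even}}(I_Z,I_Z)_0$ (resp. $\mathrm{Ext}^{\mathrm{odd}}(I_Z,I_Z)_0$) is the sum of the $\mathrm{Ext}^{i}(I_Z,I_Z)_0$ over even (resp. odd)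 $i$ in $K_{(\mathbb{C}^* )^d}(\mathrm{pt})$. For a virtual representation $\sum_w a_w t^w$, the equivariant Euler class is $e(\sum_w a_wt^w)=\prod_w (w_1\lambda_1+\cdots+w_d\lambda_d)^{a_w}$ (equal to $0$ if the trivial character has positive coefficient, and only defined if this coefficient is non-negative); quotients $e(\mathrm{Ext}^{\mathrm{even}})/e(\mathrm{Ext}^{\mathrm{odd}})$ mean the Euler class of the virtual difference. For $d$ odd, $$Z_n(\mathbb{C}^d):=\sum_{[Z]\in\mathrm{Hilb}^n(\mathbb{C}^d)^{(\mathbb{C}^* )^d}}\frac{e_{(\mathbb{C}^* )^d}(\mathrm{Ext}^{\mathrm{even}}(I_Z,I_Z)_0)}{e_{(\mathbb{C}^* )^d}(\mathrm{Ext}^{\mathrm{odd}}(I_Z,I_Z)_0)}\in\mathbb{Q}(\lambda_1,\ldots,\lambda_d).$$ *)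

(* Defs.v *)
From HB Require Import structures.
From mathcomp Require Import all_boot all_order all_algebra.
From mathcomp Require Import finmap boolp classical_sets functions cardinality fsbigop.
From mathcomp Require Import reals.
From mathcomp Require Import complex.
From mathcomp Require Import mpoly.

Set Implicit Arguments.
Unset Strict Implicit.
Unset Printing Implicit Defensive.

Import Order.TTheory GRing.Theory Num.Theory.

Local Open Scope classical_set_scope.
Local Open Scope ring_scope.

(* Exponents of monomials of C[x_1, ..., x_d], and characters of (C^* )^d; the
   monomial x^u has character t^u. *)
Notation expo d := {ffun 'I_d -> nat}.
Notation weight d := {ffun 'I_d -> int}.

Definition expo_le d (u v : expo d) : bool := [forall i, (u i <= v i)%N].
Definition weight_le d (u v : weight d) : bool := [forall i, u i <= v i].
Definition expo_weight d (u : expo d) : weight d := [ffun i => (u i)%:Z].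

(* Indices start at 0 instead of 1. *)
Definition is_partition k (p : expo k -> nat) : Prop :=
  (forall u v, expo_le u v -> (p v <= p u)%N) /\
  finite_set [set u | p u != 0%N].

Definition partition_size k (p : expo k -> nat) : nat :=
  (\sum_(u \in [set: expo k]) p u)%N.

(* A formal power series in q is the sequence of its coefficients. *)
Definition M_series (k : nat) : nat -> rat := fun m =>
  #|` fset_set [set p : expo k -> nat | is_partition p /\ partition_size p = m]
    |%:R.

Definition subst_opp_q (f : nat -> rat) : nat -> rat :=
  fun m => (-1) ^+ m * f m.

(* A monomial ideal is given by the set of exponents of the monomials it
   contains; its colength is the number of the remaining monomials. *)
Definition monomial_ideal d (I : set (expo d)) : Prop :=
  forall u v, expo_le u v -> I u -> I v.

Definition Hilb_fixed d (n : nat) : set (set (expo d)) :=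
  [set I | monomial_ideal I /\ (~` I #= `I_n)%card].
Arguments Hilb_fixed : clear implicits.

(* With S = C[x_1, ..., x_d], a bounded complex F of Z^d-graded free S-modules
   of finite rank, with an augmentation F_0 -> S. The index j runs over a
   homogeneous basis (e_j) of the direct sum of all F_k: e_j lies in
   F_(fc_hdeg j) and has weight fc_wt j. By homogeneity, each entry of a matrix
   over S is a scalar multiple of a prescribed monomial:
     d(e_j) = \sum_l fc_diff j l * x^(fc_wt j - fc_wt l) * e_l,
     eps(e_j) = fc_aug j 0 * x^(fc_wt j),
   so that only the scalars are recorded. Maps act on row vectors from the
   right; the product of the scalar matrices represents the composition. *)
Record free_complex (K : fieldType) (d : nat) := FreeComplex {
  fc_rank : nat;
  fc_hdeg : 'I_fc_rank -> nat;
  fc_wt : 'I_fc_rank -> weight d;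
  fc_diff : 'M[K]_fc_rank;
  fc_aug : 'cV[K]_fc_rank
}.

Section Resolution.
Variables (K : fieldType) (d : nat) (F : free_complex K d).
Local Notation N := (fc_rank F).
Local Notation hdeg := (@fc_hdeg K d F).
Local Notation wt := (@fc_wt K d F).
Local Notation D := (fc_diff F).
Local Notation aug := (fc_aug F).

(* v represents the element \sum_j v_j x^(w - wt j) e_j of weight w of F_k. *)
Definition fc_piece (k : nat) (w : weight d) (v : 'rV[K]_N) : Prop :=
  forall j, v 0 j != 0 -> hdeg j = k /\ weight_le (wt j) w.

(* F is a resolution  ... -> F_1 -> F_0 -> I -> 0; exactness is expressed
   weight by weight. *)
Definition resolves (I : set (expo d)) : Prop :=
  [/\ (forall j l, D j l != 0 -> hdeg j = (hdeg l).+1 /\ weight_le (wt l) (wt j)),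
      (forall j, aug j 0 != 0 ->
         hdeg j = 0%N /\ exists2 u, I u & wt j = expo_weight u),
      D *m D = 0 /\ D *m aug = 0,
      (forall u, I u ->
         exists2 v, fc_piece 0 (expo_weight u) v & v *m aug = 1%:M)
    & (forall k w v, fc_piece k w v -> v *m D = 0 -> v *m aug = 0 ->
         exists2 v', fc_piece k.+1 w v' & v = v' *m D)].

(* Ext^i(I, I) is the i-th cohomology of the complex Hom(F, F), whose term of
   degree i and weight w consists of the maps
     e_j |-> \sum_l phi j l * x^(wt j + w - wt l) * e_l
   lowering the homological degree by i. *)
Definition Hom_piece (i : int) (w : weight d) : {vspace 'M[K]_N} :=
  (\sum_(p : 'I_N * 'I_N |
      (((hdeg p.1)%:Z == (hdeg p.2)%:Z + i) &&
       weight_le (wt p.2) (wt p.1 + w))%R)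
    <[delta_mx p.1 p.2]>)%VS.

(* phi |-> d o phi - (-1)^i phi o d *)
Definition Hom_diff (i : int) : 'End('M[K]_N) :=
  linfun (fun phi : 'M[K]_N => phi *m D - (-1) ^ i *: (D *m phi)).

(* The supertrace Hom(F, F) -> S; on maps of weight w it takes values in the
   multiples of x^w, and it vanishes in degrees i <> 0. It induces the trace
   Ext^i(I, I) -> H^i(O). *)
Definition supertrace : 'Hom('M[K]_N, K^o) :=
  linfun (fun phi : 'M[K]_N => \sum_j (-1) ^+ hdeg j * phi j j : K^o).

Definition Ext0_cycles (i : int) (w : weight d) : {vspace 'M[K]_N} :=
  (Hom_piece i w :&: lker (Hom_diff i) :&: lker supertrace)%VS.
Definition Ext_boundaries (i : int) (w : weight d) : {vspace 'M[K]_N} :=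
  (Hom_diff (i - 1) @: Hom_piece (i - 1) w)%VS.

(* The dimension of the t^w-isotypic part of Ext^i(I, I)_0, which is
   Ext0_cycles i w modulo its subspace Ext_boundaries i w. *)
Definition Ext0_dim (i : int) (w : weight d) : nat :=
  (\dim (Ext0_cycles i w) - \dim (Ext_boundaries i w))%N.

(* Only finitely many i contribute; Ext^i = 0 for i < 0. *)
Definition Ext0_even (w : weight d) : nat :=
  (\sum_(i \in [set i : int | ~~ odd `|i|%N]) Ext0_dim i w)%N.
Definition Ext0_odd (w : weight d) : nat :=
  (\sum_(i \in [set i : int | odd `|i|%N]) Ext0_dim i w)%N.

Definition Ext0_virtual (w : weight d) : int :=
  (Ext0_even w)%:Z - (Ext0_odd w)%:Z.

End Resolution.

Notation ratfun d := {fraction {mpoly rat[d]}}.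

(* V stands for \sum_w V w * t^w. The coefficient of the trivial character must
   be non-negative because 0^-1 = 0 in the library. *)
Definition has_euler d (V : weight d -> int) : Prop :=
  finite_set [set w | V w != 0] /\ 0 <= V 0.

Definition linear_form d (w : weight d) : {mpoly rat[d]} :=
  \sum_(i < d) (w i)%:~R *: 'X_i.

Definition euler d (V : weight d -> int) : ratfun d :=
  \big[*%R/1]_(w \in [set: weight d]) (tofrac (linear_form w) ^ V w).

(* F is a choice of a resolution of each monomial ideal. *)
Definition Z_inv (K : fieldType) d (F : set (expo d) -> free_complex K d)
    (n : nat) : ratfun d :=
  \sum_(I \in Hilb_fixed d n) euler (Ext0_virtual (F I)).

Definition Z_series (K : fieldType) d (F : set (expo d) -> free_complex K d) :
    nat -> ratfun d :=
  fun n => if n is 0%N then 1 else Z_inv F n.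

(* Substitution of - (lambda_1 + ... + lambda_(d-1)) for lambda_d, which
   identifies Q[lambda] / (lambda_1 + ... + lambda_d) with the polynomials in
   lambda_1, ..., lambda_(d-1). *)
Definition restrict_CY d (p : {mpoly rat[d]}) : {mpoly rat[d]} :=
  p \mPo [tuple (if (i.+1 == d)%N then - \sum_(j < d | (j.+1 < d)%N) 'X_j
                 else 'X_i) | i < d].

(* f is regular at the generic point of the hyperplane, and its restriction is
   the function g; such a g is unique. *)
Definition specializes_CY d (f g : ratfun d) : Prop :=
  exists p q : {mpoly rat[d]},
    [/\ restrict_CY q != 0,
        f = tofrac p / tofrac q
      & g = tofrac (restrict_CY p) / tofrac (restrict_CY q)].

(* Main.v *)
Require Import Defs.
From HB Require Import structures.
From mathcomp Require Import all_boot all_order all_algebra.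
From mathcomp Require Import finmap.
From mathcomp Require Import boolp classical_sets functions cardinality fsbigop.
From mathcomp Require Import reals.
From mathcomp Require Import complex.
From mathcomp Require Import mpoly.
From mathcomp Require Import zify ring.

(** Let S = C[x_1, ..., x_d] and let I be a monomial ideal of colength n.  Write
    Q for the sum of the t^u over the n monomials x^u outside I, kappa for
    the product t_1 ... t_d, and f~ for f with every t_i inverted.

    A graded free resolution of I has K-polynomial P = 1 - Q prod_i (1 - t_i)
    (lemma [K_polynomial]), and the alternating sum of the Ext^i(I, I) is
    P P~ / prod_i (1 - t_i), since the Euler characteristic of the complex
    Hom(F, F) can be computed from its terms.  The trace is onto H^0(O), because
    the rank of I is 1 and so multiplication by a monomial has that monomial as
    its supertrace; passing to trace-free parts therefore subtracts
    1 / prod_i (1 - t_i).  For odd d this leaves (lemma [Ext0_vertex])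

      V = - Q + kappa^-1 Q~ + Q Q~ prod_i (1 - t_i^-1).

    This character is a difference V = W - kappa^-1 W~ (lemma [vertex_half]), where

      W = - Q + Q Q~ prod_(i <> i0) (1 - t_i^-1)

    for an arbitrary coordinate i0.  On the hyperplane where the lambda_i sum
    to 0 the linear forms of t^w and of kappa^-1 t^(-w) are opposite, so each pair
    of factors of the Euler class contributes a sign, and the product of all
    signs is -1 to the power W(t = 1).  As d >= 2 the second summand of W
    vanishes at t = 1, so the exponent is -n (lemma [sum_half_vertex]) and the
    Euler class of V restricts to (-1)^n (lemma [specializes_euler_vertex]).

    The argument needs the Euler class to have neither zeros nor poles along
    the hyperplane.  The linear forms that vanish there are those of the powers
    of kappa, and their coefficients in V are all 0 (lemma [vertex_diag]): for
    c >= 0 inclusion-exclusion shows that kappa^c has the same coefficient in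
    Q Q~ prod_i (1 - t_i^-1) as in Q, because the monomials outside I are closed
    under taking divisors; negative powers follow from V = - kappa^-1 V~.

    Hence Z_n restricts to (-1)^n times the number of monomial ideals of colength
    n.  Stacking boxes along the last coordinate identifies these with the
    (d-1)-partitions of size n (lemma [Hilb_fixed_partitions]). *)

Set Implicit Arguments.
Unset Strict Implicit.
Unset Printing Implicit Defensive.

Import Order.TTheory GRing.Theory Num.Theory.
Local Open Scope classical_set_scope.
Local Open Scope ring_scope.

(** * Coordinate subspaces of matrix spaces *)

Section CoordinateSubspaces.
Variables (K : fieldType) (m n : nat).
Implicit Types (P : pred ('I_m * 'I_n)) (A : 'M[K]_(m, n)).

Definition coordspace P : {vspace 'M[K]_(m, n)} :=
  (\sum_(p | P p) <[delta_mx p.1 p.2]>)%VS.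

Lemma mem_coordspace P A :
  (A \in coordspace P) <-> (forall i j, A i j != 0 -> P (i, j)).
Proof.
split=> [/memv_sumP[v Pv ->] i j|PA].
  rewrite summxE; apply: contra_neqT => nPij.
  rewrite big1 // => p Pp; have /vlineP[a ->] := Pv p Pp.
  rewrite !mxE; case: eqP => [ip|]; last by rewrite mulr0.
  case: eqP => [jp|]; last by rewrite mulr0.
  by move: nPij; rewrite ip jp -surjective_pairing Pp.
rewrite (matrix_sum_delta A) pair_bigA /=.
apply: memv_suml => -[i j] _ /=.
have [->|/PA Pij] := eqVneq (A i j) 0; first by rewrite scale0r mem0v.
rewrite memvZ //; apply: subvP (memv_line _).
exact: (sumv_sup (i, j)).
Qed.

(** The spanning family is part of the standard basis.  A dimension count
    replaces a proof of freeness: both P and its complement give at most as many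
    dimensions as they have elements, and together they span everything. *)
Lemma dim_coordspace P : \dim (coordspace P) = #|P|.
Proof.
have le_dim (Q : pred ('I_m * 'I_n)) : (\dim (coordspace Q) <= #|Q|)%N.
  apply: leq_trans (dimv_leq_sum _ _ _) _.
  rewrite -sum1_card; apply: leq_sum => p _.
  by rewrite dim_vline leq_b1.
have split_full : (fullv <= coordspace P + coordspace (predC P))%VS.
  apply/subvP => A _; pose B := \matrix_(i, j) if P (i, j) then A i j else 0.
  rewrite -(subrKC B A); apply: memv_add; apply/mem_coordspace => i j /=.
    by rewrite mxE; case: ifP => //; rewrite eqxx.
  by rewrite !mxE; case: ifP => //; rewrite subrr eqxx.
apply/eqP; rewrite eqn_leq le_dim /= -(leq_add2r #|predC P|).
rewrite cardC card_prod !card_ord.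
apply: (@leq_trans (\dim (coordspace P) + \dim (coordspace (predC P)))).
  have <- : dim 'M[K]_(m, n) = (m * n)%N by [].
  rewrite -dimvf; apply: leq_trans (dimvS split_full) _.
  exact: dimv_add_leqif.
by rewrite leq_add2l.
Qed.
End CoordinateSubspaces.

Lemma mulmx_neq0P (K : fieldType) (m n p : nat) (A : 'M[K]_(m, n)) (B : 'M[K]_(n, p)) i k :
  (A *m B) i k != 0 -> exists2 j, A i j != 0 & B j k != 0.
Proof.
rewrite mxE => nz; have [j] : exists j, A i j * B j k != 0.
  apply: contraNP nz => /forallNP z; rewrite big1 // => j _.
  by apply/eqP; have := z j; case: eqP.
by rewrite mulf_eq0 negb_or => /andP[]; exists j.
Qed.

Lemma dim_limg_line (K : fieldType) (aT rT : vectType K) (f : 'Hom(aT, rT))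
    (U : {vspace aT}) (b : bool) :
    dim rT = 1%N -> (b <-> exists2 v, v \in U & f v != 0) ->
  \dim (f @: U) = b.
Proof.
move=> rT1 bE; apply/eqP; rewrite eqn_leq; apply/andP; split; last first.
  case: b bE => // -[/(_ isT)[v Uv fv0] _].
  by rewrite lt0n dimv_eq0 -subv0; apply: contra fv0 => /subvP/(_ (f v));
    rewrite memv0; apply; apply: memv_img.
case: b bE => [_|[_ noU]].
  by apply: leq_trans (dimvS (subvf _)) _; rewrite dimvf rT1.
rewrite leqn0 dimv_eq0 -subv0; apply/subvP => _ /memv_imgP[v Uv ->].
by rewrite memv0; apply: contraT => fv0; apply: noU; exists v.
Qed.

(** * Alternating sums *)

(** With b k the rank of the differential between two consecutive terms, this is
    the cancellation behind the invariance of the Euler characteristic. *)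
Lemma alternating_telescope (b : nat -> int) M :
  \sum_(k < M) (-1) ^+ k * (b k.+1 + b k) = b 0%N - (-1) ^+ M * b M.
Proof.
elim: M => [|M IH]; first by rewrite big_ord0; ring.
by rewrite big_ord_recr /= IH exprS; ring.
Qed.

Lemma alternating_card (T : finType) (deg : T -> nat) (P : pred T) M :
    (forall x, P x -> deg x < M)%N ->
  \sum_(k < M) (-1) ^+ k * #|[pred x | (deg x == k) && P x]|%:Z =
  \sum_(x | P x) (-1) ^+ deg x.
Proof.
move=> ltM; rewrite (eq_bigr (fun k : 'I_M =>
    \sum_(x | (deg x == k) && P x) (-1) ^+ deg x)) => [|k _]; last first.
  under eq_bigr => x /andP[/eqP -> _] do [].
  by rewrite sumr_const -mulr_natr natz.
rewrite (exchange_big_dep P) => [|k x _ /andP[] //] /=.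
apply: eq_bigr => x Px.
rewrite (big_pred1 (Ordinal (ltM x Px))) // => k.
by rewrite Px andbT eq_sym.
Qed.

(** * Weights *)

Section Weights.
Variable d : nat.

Lemma weight_leP (v w : weight d) : reflect (forall i, v i <= w i) (weight_le v w).
Proof. exact: forallP. Qed.

Lemma weight_le_trans (u v w : weight d) :
  weight_le u v -> weight_le v w -> weight_le u w.
Proof.
move=> /weight_leP uv /weight_leP vw; apply/weight_leP => i.
exact: le_trans (uv i) (vw i).
Qed.

Lemma weight_le_add (u v w : weight d) :
  weight_le u v -> weight_le (u + w) (v + w).
Proof. by move=> /weight_leP uv; apply/weight_leP => i; rewrite !ffunE lerD2r. Qed.

End Weights.

Lemma expo_weight_inj d : injective (@expo_weight d).
Proof.
by move=> u v /ffunP uv; apply/ffunP => i; have := uv i; rewrite !ffunE => -[].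
Qed.

Lemma weight_nonnegP d (w : weight d) :
  reflect (exists u, w = expo_weight u) (weight_le 0%R w).
Proof.
apply: (iffP (weight_leP _ _)) => [w0|[u ->] i]; last by rewrite !ffunE.
exists [ffun i => `|w i|%N]; apply/ffunP => i; rewrite !ffunE gez0_abs //.
by have := w0 i; rewrite ffunE.
Qed.

(** * The Hilbert function of a resolved ideal *)

Section Resolution.
Variables (K : fieldType) (d : nat) (F : free_complex K d).
Local Notation N := (fc_rank F).
Local Notation hdeg := (@fc_hdeg K d F).
Local Notation wt := (@fc_wt K d F).
Local Notation D := (fc_diff F).
Local Notation aug := (fc_aug F).

Definition hdeg_bound := \max_j hdeg j.

Lemma hdeg_leq j : (hdeg j <= hdeg_bound)%N.
Proof. exact: leq_bigmax. Qed.

Variable I : set (expo d).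
Hypothesis idealI : monomial_ideal I.
Hypothesis resF : resolves F I.

Definition in_ideal (w : weight d) : bool := `[< exists2 u, I u & w = expo_weight u >].

Let piece k w : {vspace 'rV[K]_N} :=
  coordspace K [pred p : 'I_1 * 'I_N | (hdeg p.2 == k) && weight_le (wt p.2) w].

Let mem_piece k w v : (v \in piece k w) <-> fc_piece k w v.
Proof.
rewrite mem_coordspace; split=> [Pv j /Pv /= /andP[/eqP]//|Pv i j].
by rewrite ord1 => /Pv[hj wj] /=; rewrite hj eqxx.
Qed.

Let rD : 'End('rV[K]_N) := linfun (mulmxr D).
Let raug : 'Hom('rV[K]_N, 'M[K]_1) := linfun (mulmxr aug).

Lemma in_ideal_le u w : I u -> weight_le (expo_weight u) w -> in_ideal w.
Proof.
move=> Iu /weight_leP uw; apply/asboolP.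
have w_ge0 i : 0 <= w i by apply: le_trans (uw i); rewrite ffunE.
exists [ffun i => `|w i|%N].
  apply: idealI Iu; apply/forallP => i; rewrite ffunE.
  by rewrite -lez_nat gez0_abs // -[leLHS]/((u i)%:Z) -[_%:Z](ffunE (fun i => (u i)%:Z)); exact: uw.
by apply/ffunP => i; rewrite !ffunE gez0_abs.
Qed.

Let piece_diff k w v : v \in piece k.+1 w -> v *m D \in piece k w.
Proof.
have [degD _ _ _ _] := resF.
move=> /mem_piece Pv; apply/mem_piece => l.
move=> /mulmx_neq0P[j /Pv[dj wj] /degD[dl wl]].
split; last exact: weight_le_trans wl wj.
by move: dl; rewrite dj => -[].
Qed.

Let diff_piece0 w v : v \in piece 0 w -> v *m D = 0.
Proof.
have [degD _ _ _ _] := resF.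
move=> /mem_piece Pv; apply/rowP => l; rewrite !mxE big1 // => j _.
apply/eqP; rewrite mulf_eq0 -implyNb; apply/implyP => /Pv[dj _].
by apply: contraT => /degD[]; rewrite dj.
Qed.

Let aug_piece k w v : v \in piece k w -> v *m aug != 0 -> k = 0%N /\ in_ideal w.
Proof.
have [_ degaug _ _ _] := resF.
move=> /mem_piece Pv; apply: contra_neqP => nk; apply/matrixP => i l.
rewrite !mxE !ord1 big1 // => j _; apply/eqP; rewrite mulf_eq0 -implyNb.
apply/implyP => /Pv[dj wj]; apply: contraT => /degaug[d0 [u Iu wu]].
case: nk; split; first by rewrite -dj.
by apply: in_ideal_le Iu _; rewrite -wu.
Qed.

Let aug_piece_dim w : \dim (raug @: piece 0 w) = in_ideal w.
Proof.
have [_ _ _ aug_onto _] := resF.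
apply: dim_limg_line => //; split=> [/asboolP[u Iu ->]|[v Pv]].
  have [v /mem_piece Pv v1] := aug_onto u Iu.
  by exists v => //; rewrite lfunE /= v1 oner_neq0.
by rewrite lfunE /= => /(aug_piece Pv)[].
Qed.

Let piece_exact k w v : v \in piece k w -> v *m D = 0 -> v *m aug = 0 ->
  v \in (rD @: piece k.+1 w)%VS.
Proof.
have [_ _ _ _ exactF] := resF.
move=> /mem_piece Pv vD va; have [v' /mem_piece Pv' ->] := exactF _ _ _ Pv vD va.
by apply/memv_imgP; exists v'; rewrite ?lfunE.
Qed.

Let boundary_piece k w v : v \in (rD @: piece k.+1 w)%VS ->
  [/\ v \in piece k w, v *m D = 0 & v *m aug = 0].
Proof.
have [_ _ [DD Daug] _ _] := resF.
move=> /memv_imgP[v' Pv' ->]; rewrite lfunE /= -!mulmxA DD Daug !mulmx0.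
by split=> //; apply: piece_diff.
Qed.

Let dim_piece k w :
  \dim (piece k w) =
  (\dim (rD @: piece k.+1 w) + \dim (rD @: piece k w)
   + (k == 0) * in_ideal w)%N.
Proof.
case: k => [|k].
  have -> : \dim (rD @: piece 0 w) = 0%N.
    apply/eqP; rewrite dimv_eq0 -subv0; apply/subvP => _ /memv_imgP[v Pv ->].
    by rewrite memv0 lfunE /= (diff_piece0 Pv).
  rewrite addn0 mul1n -aug_piece_dim -[LHS](limg_ker_dim raug).
  congr (\dim _ + _)%N.
  apply/vspaceP => v; rewrite memv_cap memv_ker lfunE /=.
  apply/andP/idP => [[Pv /eqP va]|/boundary_piece[-> _ ->] //].
  exact: piece_exact Pv (diff_piece0 Pv) va.
rewrite mul0n addn0 -[LHS](limg_ker_dim rD); congr (\dim _ + _)%N.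
apply/vspaceP => v; rewrite memv_cap memv_ker lfunE /=.
apply/andP/idP => [[Pv /eqP vD]|/boundary_piece[-> -> _] //].
apply: piece_exact (Pv) vD _; apply/eqP; apply: contraT.
by move=> /(aug_piece Pv)[].
Qed.

(** The weight w part of the resolution is an exact complex of finite dimensional
    spaces, and the weight w part of I is at most a line. *)
Lemma resolution_Euler_char w :
  \sum_j (-1) ^+ hdeg j * (weight_le (wt j) w)%:R = (in_ideal w)%:R :> int.
Proof.
pose b k : int := (\dim (rD @: piece k w))%:Z.
rewrite (eq_bigr (fun j => if weight_le (wt j) w then (-1) ^+ hdeg j else 0));
  last by move=> j _; case: ifP; rewrite ?mulr1 ?mulr0.
rewrite -big_mkcond /=.
rewrite -(@alternating_card _ _ _ hdeg_bound.+1) => [|j _]; last first.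
  by rewrite ltnS hdeg_leq.
transitivity (\sum_(k < hdeg_bound.+1)
   ((-1) ^+ k * (b k.+1 + b k) + (k == 0 :> nat)%:R * (in_ideal w)%:R)).
  apply: eq_bigr => k _.
  have -> : #|[pred x | (hdeg x == k) & weight_le (wt x) w]| = \dim (piece k w).
    rewrite dim_coordspace.
    rewrite -[LHS]mul1n -[X in (X * _)%N](card_ord 1) -cardX.
    by apply: eq_card => p; rewrite !inE.
  rewrite dim_piece !PoszD mulrDr; congr (_ + _).
  by case: (k : nat) => [|n] /=; rewrite ?mul1n ?mul0n ?mulr0 ?mul0r // !mul1r natz.
rewrite big_split /= alternating_telescope.
have -> : b 0%N = 0.
  apply/eqP; rewrite eqz_nat dimv_eq0 -subv0; apply/subvP => _ /memv_imgP[v Pv ->].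
  by rewrite memv0 lfunE /= (diff_piece0 Pv).
have -> : b hdeg_bound.+1 = 0.
  apply/eqP; rewrite eqz_nat dimv_eq0 -subv0; apply/subvP => _ /memv_imgP[v Pv ->].
  suff -> : v = 0 by rewrite linear0 mem0v.
  apply/rowP => j; rewrite mxE; apply/eqP; apply: contraT.
  have /mem_piece PvE := Pv; by move=> /PvE[hj _]; have := hdeg_leq j; rewrite hj ltnn.
rewrite mulr0 subr0 add0r big_ord_recl big1 ?addr0 ?mul1r // => k _.
by rewrite mul0r.
Qed.

End Resolution.

(** * Euler characteristic of the trace-free Ext groups *)

Section Ext.
Variables (K : fieldType) (d : nat) (F : free_complex K d).
Local Notation N := (fc_rank F).
Local Notation hdeg := (@fc_hdeg K d F).
Local Notation wt := (@fc_wt K d F).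
Local Notation D := (fc_diff F).

Hypothesis degD : forall j l, D j l != 0 ->
  hdeg j = (hdeg l).+1 /\ weight_le (wt l) (wt j).
Hypothesis DD : D *m D = 0.
Hypothesis rank1 : \sum_j (-1) ^+ hdeg j = 1 :> int.

Lemma mem_Hom_piece i w (phi : 'M[K]_N) :
  (phi \in Hom_piece F i w) <->
  (forall j l, phi j l != 0 ->
     (hdeg j)%:Z = (hdeg l)%:Z + i /\ weight_le (wt l) (wt j + w)).
Proof.
rewrite mem_coordspace; split=> [Pphi j l /Pphi /= /andP[/eqP]//|Pphi j l].
by move=> /Pphi[-> wjl] /=; rewrite eqxx.
Qed.

Lemma Hom_diffE i (phi : 'M[K]_N) :
  Hom_diff F i phi = phi *m D - (-1) ^ i *: (D *m phi).
Proof.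
have lin : linear (fun phi : 'M[K]_N => phi *m D - (-1) ^ i *: (D *m phi)).
  move=> a u v; rewrite mulmxDl mulmxDr scalerDr -scalemxAl -scalemxAr.
  by rewrite !scalerBr !scalerA [a * _]mulrC opprD addrACA.
pose f : {linear 'M[K]_N -> 'M[K]_N} := HB.pack
  (fun phi : 'M[K]_N => phi *m D - (-1) ^ i *: (D *m phi))
  (GRing.isLinear.Build _ _ _ _ _ lin).
exact: (lfunE f).
Qed.

Lemma supertraceE (phi : 'M[K]_N) :
  supertrace F phi = \sum_j (-1) ^+ hdeg j * phi j j.
Proof.
have lin : linear (fun phi : 'M[K]_N => \sum_j (-1) ^+ hdeg j * phi j j : K^o).
  move=> a u v; rewrite scaler_sumr -big_split /=; apply: eq_bigr => j _.
  by rewrite !mxE mulrDr mulrCA.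
pose f : {linear 'M[K]_N -> K^o} := HB.pack
  (fun phi : 'M[K]_N => \sum_j (-1) ^+ hdeg j * phi j j : K^o)
  (GRing.isLinear.Build _ _ _ _ _ lin).
exact: (lfunE f).
Qed.

Lemma Hom_diff_piece i w (phi : 'M[K]_N) :
  phi \in Hom_piece F i w -> Hom_diff F i phi \in Hom_piece F (i + 1) w.
Proof.
rewrite Hom_diffE => /mem_Hom_piece Pphi.
apply: memvB; last apply: memvZ; apply/mem_Hom_piece => j l /mulmx_neq0P[k].
  move=> /Pphi[jk wjk] /degD[kl wkl]; split; last exact: weight_le_trans wkl wjk.
  by rewrite jk kl -addn1 PoszD -addrA [1 + i]addrC addrA.
move=> /degD[jk wjk] /Pphi[kl wkl]; split.
  by rewrite jk -addn1 PoszD kl addrA.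
exact: weight_le_trans wkl (weight_le_add _ wjk).
Qed.

Lemma Hom_diff_diff i (phi : 'M[K]_N) : Hom_diff F (i + 1) (Hom_diff F i phi) = 0.
Proof.
rewrite !Hom_diffE mulmxBl mulmxBr -!scalemxAl -!scalemxAr !mulmxA.
rewrite DD -(mulmxA phi) DD.
rewrite mulmx0 mul0mx scaler0 !sub0r subr0 expfzDr ?oppr_eq0 ?oner_neq0 //.
by rewrite expr1z mulrN1 scaleNr opprK addNr.
Qed.

Lemma Hom_piece_diag i w (phi : 'M[K]_N) j : phi \in Hom_piece F i w ->
  ~~ ((i == 0) && weight_le 0 w) -> phi j j = 0.
Proof.
move=> /mem_Hom_piece Pphi; apply: contraNeq => /Pphi[dj wj].
apply/andP; split; first by rewrite -(inj_eq (addrI (hdeg j)%:Z)) addr0 -dj.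
apply/weight_leP => k; move/weight_leP/(_ k): wj.
by rewrite !ffunE lerDl.
Qed.

(** Only degree 0 has diagonal entries.  There the boundary of phi is the
    anticommutator with D, and the signs (-1)^(hdeg j) of the two products are
    opposite because D changes the homological degree by one. *)
Lemma supertrace_boundary i w (phi : 'M[K]_N) :
  phi \in Hom_piece F (i - 1) w -> supertrace F (Hom_diff F (i - 1) phi) = 0.
Proof.
move=> Pphi; have [->|i0] := eqVneq i 0; last first.
  rewrite supertraceE big1 // => j _.
  rewrite (Hom_piece_diag _ (Hom_diff_piece Pphi)) ?mulr0 //.
  by rewrite subrK negb_and i0.
rewrite Hom_diffE sub0r supertraceE.
rewrite -invr_expz expr1z invrN1 scaleN1r opprK.
under eq_bigr => j _ do rewrite !mxE mulrDr !mulr_sumr.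
rewrite big_split /= [X in _ + X]exchange_big -big_split /= big1 // => j _.
rewrite -big_split big1 // => l _ /=.
rewrite [D l j * _]mulrC -mulrDl.
have [->|/degD[-> _]] := eqVneq (D l j) 0; first by rewrite !mulr0.
by rewrite exprS mulN1r subrr mul0r.
Qed.

Lemma Ext_boundaries_sub i w : (Ext_boundaries F i w <= Ext0_cycles F i w)%VS.
Proof.
apply/subvP => _ /memv_imgP[phi Pphi ->].
rewrite !memv_cap !memv_ker (supertrace_boundary Pphi) eqxx andbT.
have := Hom_diff_piece Pphi; have := Hom_diff_diff (i - 1) phi.
by rewrite subrK => -> ->; rewrite eqxx.
Qed.

(** In weights w >= 0 the cycle 1, that is multiplication by x^w, has
    supertrace 1 by [rank1]; in all other weights every supertrace vanishes. *)
Lemma dim_Ext0_cycles i w :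
  \dim (Hom_piece F i w :&: lker (Hom_diff F i)) =
  (\dim (Ext0_cycles F i w) + ((i == 0%R) && weight_le 0%R w))%N.
Proof.
rewrite -[LHS](limg_ker_dim (supertrace F)); congr (_ + _)%N.
apply: dim_limg_line => //; split=> [/andP[/eqP-> w0]|[phi]].
  exists 1%:M; last first.
    rewrite supertraceE.
    have -> : \sum_j (-1) ^+ hdeg j * 1%:M j j =
              (\sum_j (-1) ^+ hdeg j : int)%:~R :> K.
      rewrite rmorph_sum; apply: eq_bigr => j _.
      by rewrite mxE eqxx mulr1 rmorphXn rmorphN1.
    by rewrite rank1 oner_neq0.
  rewrite memv_cap memv_ker Hom_diffE mulmx1 mul1mx expr0z scale1r subrr eqxx andbT.
  apply/mem_Hom_piece => j l; rewrite mxE.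
  have [->|_] := eqVneq j l; last by rewrite eqxx.
  rewrite addr0; split=> //.
  by have := weight_le_add (wt l) w0; rewrite add0r addrC.
rewrite memv_cap => /andP[Pphi _]; apply: contra_neqT => n0.
by rewrite supertraceE big1 // => j _; rewrite (Hom_piece_diag _ Pphi) ?mulr0.
Qed.

Lemma Ext0_dimE i w :
  (Ext0_dim F i w)%:Z = (\dim (Hom_piece F i w))%:Z
    - ((\dim (Ext_boundaries F (i + 1) w))%:Z + (\dim (Ext_boundaries F i w))%:Z)
    - ((i == 0) && weight_le 0 w)%:R.
Proof.
rewrite /Ext0_dim -(limg_ker_dim (Hom_diff F i) (Hom_piece F i w)) dim_Ext0_cycles.
rewrite -subzn ?dimvS ?Ext_boundaries_sub // /Ext_boundaries addrK !PoszD.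
by rewrite natz; ring.
Qed.

Lemma Hom_piece_eq0 i w : (`|i| > hdeg_bound F)%N -> Hom_piece F i w = 0%VS.
Proof.
move=> big_i; apply/eqP; rewrite -subv0; apply/subvP => phi /mem_Hom_piece Pphi.
rewrite memv0; apply/eqP/matrixP => j l; rewrite mxE.
apply/eqP; apply: contraTT big_i => /Pphi[dj _].
by have := hdeg_leq j; have := hdeg_leq l; lia.
Qed.

(** The sign of a degree i map from e_j to e_l is (-1)^i, which is the product of
    the signs of e_j and e_l.  The subtracted indicator is the weight w part of
    H^0(O), the image of the trace. *)
Lemma Ext0_virtualE w :
  Ext0_virtual F w =
  \sum_j \sum_l (-1) ^+ hdeg j * (-1) ^+ hdeg l * (weight_le (wt l) (wt j + w))%:R
  - (weight_le 0 w)%:R.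
Proof.
pose B := hdeg_bound F.
(* Hom(F, F) lives in degrees -B, ..., B; shifting by B makes them naturals. *)
pose deg (k : nat) : int := k%:Z - B%:Z.
have deg_inj : injective deg by move=> k k' /addIr[].
pose r := [seq deg k | k <- iota 0 (B + B).+1].
have r_uniq : uniq r by rewrite map_inj_uniq ?iota_uniq.
have r_out i : i \notin r -> Ext0_dim F i w = 0%N.
  move=> ir; have big_i : (`|i| > B)%N.
    rewrite ltnNge; apply: contra ir => le_i; apply/mapP.
    exists (absz (i + B%:Z)); first by rewrite mem_iota; lia.
    by rewrite /deg; lia.
  by rewrite /Ext0_dim /Ext0_cycles Hom_piece_eq0 // !cap0v dimv0.
have evenE (P : pred int) :
    (\sum_(i \in [set i | P i]) Ext0_dim F i w)%N =
    (\sum_(k < (B + B).+1 | P (deg k)) Ext0_dim F (deg k) w)%N.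
  rewrite (fsbigE [seq i <- r | P i]) ?filter_uniq //.
  - rewrite big_filter_cond big_map -[iota _ _]/(index_iota 0 (B + B).+1) big_mkord.
    apply: eq_bigl => k; apply/andP/idP => [[]//|Pk].
    by split=> //; apply/mem_set.
  - move=> i ir; have : i \in [seq i <- r | P i] := ir.
    by rewrite mem_filter => /andP[].
  - by move=> i Pi; rewrite mem_filter Pi /= => /r_out.
rewrite /Ext0_virtual /Ext0_even /Ext0_odd !evenE !(big_morph Posz PoszD (erefl _)).
pose b k : int := (\dim (Ext_boundaries F (deg k) w))%:Z.
transitivity ((-1) ^+ B * \sum_(k < (B + B).+1)
    (-1) ^+ k * (Ext0_dim F (deg k) w)%:Z).
  rewrite big_mkcond [X in _ - X]big_mkcond -sumrB mulr_sumr.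
  apply: eq_bigr => k _.
  have -> : (-1) ^+ B * ((-1) ^+ k * (Ext0_dim F (deg k) w)%:Z) =
            (-1) ^+ `|deg k| * (Ext0_dim F (deg k) w)%:Z.
    rewrite mulrA -exprD -signr_odd -[in RHS]signr_odd; congr ((-1) ^+ nat_of_bool _ * _).
    by rewrite /deg; lia.
  by rewrite -signr_odd; case: (odd _); rewrite ?expr0 ?expr1; ring.
transitivity ((-1) ^+ B * (\sum_(k < (B + B).+1)
    (-1) ^+ k * (\dim (Hom_piece F (deg k) w))%:Z) - (weight_le 0 w)%:R).
  pose e : int := (weight_le 0 w)%:R.
  transitivity ((-1) ^+ B * (\sum_(k < (B + B).+1)
    ((-1) ^+ k * (\dim (Hom_piece F (deg k) w))%:Z
     - (-1) ^+ k * (b k.+1 + b k) - (k == B :> nat)%:R * (-1) ^+ B * e))).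
    congr (_ * _); apply: eq_bigr => k _; rewrite Ext0_dimE.
    have -> : deg k + 1 = deg k.+1 by rewrite /deg; lia.
    have -> : (deg k == 0) = (k == B :> nat) by rewrite /deg; lia.
    case: eqP => [->|_] /=; rewrite /b /e; ring.
  rewrite !sumrB alternating_telescope mulrBr mulrBr; congr (_ - _).
    (* The boundaries in degree -B come from the zero term in degree -B - 1, those in
       degree B + 1 lie in a zero term. *)
    have -> : b 0%N = 0.
      by rewrite /b /Ext_boundaries Hom_piece_eq0 ?limg0 ?dimv0 // /deg; lia.
    have -> : b (B + B).+1 = 0.
      apply/eqP; rewrite eqz_nat dimv_eq0 -subv0.
      apply: subv_trans (Ext_boundaries_sub _ _) _.
      by rewrite /Ext0_cycles Hom_piece_eq0 ?cap0v // /deg; lia.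
    by rewrite mulr0 !subr0 mulr0 subr0.
  have ltB : (B < (B + B).+1)%N by rewrite ltnS leq_addr.
  rewrite (bigD1 (Ordinal ltB)) //= big1 => [|k]; last first.
    by rewrite -val_eqE /= => /negPf ->; rewrite !mul0r.
  by rewrite eqxx mul1r addr0 mulrA -expr2 sqrr_sign mul1r.
congr (_ - _).
pose degp (p : 'I_N * 'I_N) := (hdeg p.1 + (B - hdeg p.2))%N.
have dimE k : \dim (Hom_piece F (deg k) w) =
    #|[pred p | (degp p == k) && weight_le (wt p.2) (wt p.1 + w)]|.
  rewrite dim_coordspace; apply: eq_card => -[j l]; rewrite !inE /=; congr (_ && _).
  rewrite /degp /deg /=; move: (hdeg_leq l); rewrite -/B.
  by move: (hdeg j) (hdeg l) => a c; lia.
under eq_bigr => k _ do rewrite dimE.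
rewrite alternating_card => [|p _]; last first.
  rewrite /degp; move: (hdeg_leq p.1) (hdeg_leq p.2); rewrite -/B.
  by move: (hdeg p.1) (hdeg p.2) => a c; lia.
rewrite pair_bigA mulr_sumr big_mkcond /=; apply: eq_bigr => p _.
have -> : (-1) ^+ degp p = (-1) ^+ B * (-1) ^+ hdeg p.1 * (-1) ^+ hdeg p.2 :> int.
  rewrite -!exprD -signr_odd -[RHS]signr_odd; congr ((-1) ^+ nat_of_bool _).
  rewrite /degp; move: (hdeg_leq p.2); rewrite -/B.
  by move: (hdeg p.1) (hdeg p.2) => a c; lia.
case: (weight_le _ _); last by rewrite mulr0.
by rewrite mulr1 !mulrA -expr2 sqrr_sign mul1r.
Qed.
End Ext.

(** * Inclusion-exclusion over the unit cube *)

(** The vertices of the unit cube index the terms of prod_i (1 - t_i). *)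
Notation cube d := {ffun 'I_d -> bool}.

Section Cubes.
Variable d : nat.
Implicit Types (S : cube d) (u v : expo d) (w x : weight d).

Definition cube_sign S : int := \prod_i (-1) ^+ S i.
Definition cube_weight S : weight d := [ffun i => (S i : nat)%:Z].
Definition ones : weight d := [ffun=> 1].

Lemma forall_natr (b : 'I_d -> bool) :
  [forall i, b i]%:R = \prod_i (b i)%:R :> int.
Proof.
case: forallP => [all_b|/forallP]; first by rewrite big1 // => i _; rewrite all_b.
rewrite negb_forall => /existsP[i /negPf bi].
by rewrite (bigD1 i) //= bi mul0r.
Qed.

Lemma cube_sum (g : 'I_d -> bool -> int) :
  \sum_S cube_sign S * \prod_i g i (S i) = \prod_i (g i false - g i true).
Proof.
transitivity (\prod_i \sum_(b : bool) (-1) ^+ b * g i b); last first.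
  by apply: eq_bigr => i _; rewrite big_bool expr1 mulN1r mul1r addrC.
by rewrite bigA_distr_bigA /=; apply: eq_bigr => S _; rewrite -big_split.
Qed.

Lemma eq_weight_prod w x : (w == x)%:R = \prod_i (w i == x i)%:R :> int.
Proof.
rewrite -forall_natr; congr (nat_of_bool _)%:R.
by apply/eqP/forallP => [-> i //|wx]; apply/ffunP => i; apply/eqP.
Qed.

Lemma eq_weight_cube w x :
  (w == x)%:R = \sum_S cube_sign S * (weight_le w (x - cube_weight S))%:R :> int.
Proof.
under eq_bigr => S _ do rewrite forall_natr.
rewrite eq_weight_prod.
transitivity (\prod_i ((w i <= x i)%R%:R - (w i <= x i - 1)%R%:R : int)).
  apply: eq_bigr => i _.
  have [->|wx] := eqVneq (w i) (x i); first by rewrite lexx; lia.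
  by have -> : (w i <= x i) = (w i <= x i - 1); lia.
under eq_bigr => i _ do rewrite -{1}[x i]subr0.
rewrite -(cube_sum (fun i b => (w i <= x i - (b : nat)%:Z)%R%:R)) /=.
by apply: eq_bigr => S _; under [in RHS]eq_bigr => i _ do rewrite !ffunE.
Qed.

(** A signed finite measure on weights is determined by its values on the orthants
    below a point: by [eq_weight_cube] these give the mass of every point. *)
Lemma eq_linear_of_indicators (L1 L2 : seq (int * weight d)) :
    (forall w, \sum_(p <- L1) p.1 * (weight_le p.2 w)%:R =
               \sum_(p <- L2) p.1 * (weight_le p.2 w)%:R) ->
  forall phi : weight d -> int,
    \sum_(p <- L1) p.1 * phi p.2 = \sum_(p <- L2) p.1 * phi p.2.
Proof.
move=> eqL phi.
have eq_mult w : \sum_(p <- L1) p.1 * (p.2 == w)%:R =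
                 \sum_(p <- L2) p.1 * (p.2 == w)%:R.
  have swap (L : seq (int * weight d)) : \sum_(p <- L) p.1 * (p.2 == w)%:R =
      \sum_S cube_sign S * \sum_(p <- L) p.1 * (weight_le p.2 (w - cube_weight S))%:R.
    under [RHS]eq_bigr => S _ do rewrite mulr_sumr.
    rewrite exchange_big; apply: eq_bigr => p _ /=.
    by rewrite eq_weight_cube mulr_sumr; apply: eq_bigr => S _; rewrite mulrCA.
  by rewrite !swap; apply: eq_bigr => S _; rewrite eqL.
pose X := undup (map snd (L1 ++ L2)).
have expand (L : seq (int * weight d)) : {subset L <= L1 ++ L2} ->
    \sum_(p <- L) p.1 * phi p.2 =
    \sum_(w <- X) phi w * \sum_(p <- L) p.1 * (p.2 == w)%:R.
  move=> subL; under [RHS]eq_bigr => w _ do rewrite mulr_sumr.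
  rewrite exchange_big; apply: eq_big_seq => p /subL pL /=.
  have pX : p.2 \in X by rewrite mem_undup map_f.
  rewrite (bigD1_seq p.2) ?undup_uniq //= eqxx mulr1 mulrC big1 ?addr0 // => w.
  by rewrite eq_sym => /negPf ->; rewrite !mulr0.
rewrite (expand L1) ?(expand L2) => [|p|p]; first last.
- by rewrite mem_cat => ->.
- by rewrite mem_cat => ->; rewrite orbT.
by apply: eq_bigr => w _; rewrite eq_mult.
Qed.

End Cubes.

(** * The K-polynomial and the vertex character *)

Lemma sum_eq_mem (T : eqType) (s : seq T) x :
  uniq s -> \sum_(y <- s) (y == x)%:R = (x \in s)%:R :> int.
Proof.
move=> s_uniq; have [xs|xs] := boolP (x \in s).
  by rewrite (bigD1_seq x) //= eqxx big1 ?addr0 // => y /negPf ->.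
by rewrite big_seq big1 // => y ys; case: eqP xs => // <-; rewrite ys.
Qed.

Section Vertex.
Variables (d : nat) (Q : seq (expo d)).
Implicit Types (S : cube d) (w : weight d).

(** The coefficient of t^w in V = - Q + kappa^-1 Q~ + Q Q~ prod_i (1 - t_i^-1), where
    kappa is the product of the t_i. *)
Definition vertex w : int :=
  - \sum_(u <- Q) (expo_weight u == w)%:R
  + \sum_(u <- Q) (expo_weight u == - w - ones d)%:R
  + \sum_(u <- Q) \sum_S cube_sign S *
      \sum_(v <- Q) (expo_weight v == expo_weight u + cube_weight S + w)%:R.

Section Resolution.
Variables (K : fieldType) (F : free_complex K d) (I : set (expo d)).
Local Notation hdeg := (@fc_hdeg K d F).
Local Notation wt := (@fc_wt K d F).
Hypotheses (idealI : monomial_ideal I) (resF : resolves F I).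
Hypotheses (Q_uniq : uniq Q) (memQ : forall u, u \in Q <-> ~ I u).

Lemma in_ideal_complement w :
  (in_ideal I w)%:R =
  (weight_le 0%R w)%:R - \sum_(u <- Q) (expo_weight u == w)%:R :> int.
Proof.
have [/weight_nonnegP[u ->]|w0] := boolP (weight_le 0%R w).
  under eq_bigr => v _ do rewrite (inj_eq (@expo_weight_inj d)).
  rewrite sum_eq_mem //; have [uQ|uQ] := boolP (u \in Q).
    have -> : in_ideal I (expo_weight u) = false.
      by apply/asboolP => -[v Iv /expo_weight_inj uv]; move/memQ: uQ; rewrite uv.
    by rewrite subrr.
  rewrite subr0; suff -> : in_ideal I (expo_weight u) by [].
  by apply/asboolP; exists u => //; apply: contrapT => /memQ; rewrite (negPf uQ).
rewrite big1 => [|v _]; last first.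
  by case: eqP => // vw; case/weight_nonnegP: w0; exists v.
suff -> : in_ideal I w = false by rewrite subr0.
by apply/asboolP => -[u _ wu]; case/weight_nonnegP: w0; exists u.
Qed.

(** Both sides are integrals of phi.  Against the indicator of an orthant, the left
    one is the Hilbert function of I by exactness, and the right one is that of S
    minus that of S/I. *)
Lemma K_polynomial (phi : weight d -> int) :
  \sum_j (-1) ^+ hdeg j * phi (wt j) =
  phi 0 - \sum_(u <- Q) \sum_S cube_sign S * phi (expo_weight u + cube_weight S).
Proof.
pose L1 : seq (int * weight d) := [seq ((-1) ^+ hdeg j, wt j) | j <- enum 'I_(fc_rank F)].
pose L2 : seq (int * weight d) := (1, 0) ::
  [seq (- cube_sign e, expo_weight u + cube_weight e)
     | u <- Q, e <- enum (cube d)].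
have L1E psi : \sum_(p <- L1) p.1 * psi p.2 = \sum_j (-1) ^+ hdeg j * psi (wt j).
  by rewrite big_map big_enum.
have L2E psi : \sum_(p <- L2) p.1 * psi p.2 =
    psi 0 - \sum_(u <- Q) \sum_S cube_sign S * psi (expo_weight u + cube_weight S).
  rewrite big_cons mul1r big_allpairs_dep /= -sumrN; congr (_ + _).
  apply: eq_bigr => u _; rewrite big_enum -sumrN /=.
  by apply: eq_bigr => S _; rewrite mulNr.
rewrite -L1E -L2E; apply: eq_linear_of_indicators => w.
rewrite (L1E (fun v => (weight_le v w)%:R)) (L2E (fun v => (weight_le v w)%:R)).
rewrite (resolution_Euler_char idealI resF) in_ideal_complement; congr (_ - _).
apply: eq_bigr => u _; rewrite eq_weight_cube; apply: eq_bigr => S _.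
congr (_ * (nat_of_bool _)%:R).
by apply: eq_forallb => i; rewrite !ffunE lerBrDr.
Qed.

(** The K-polynomial takes the value 1 at t = 1, as prod_i (1 - t_i) vanishes. *)
Lemma resolution_rank : (0 < d)%N -> \sum_j (-1) ^+ hdeg j = 1 :> int.
Proof.
move=> d_gt0; have := K_polynomial (fun=> 1).
under eq_bigr do rewrite mulr1; move=> ->.
rewrite big1 ?subr0 // => u _.
rewrite (eq_bigr (fun S => cube_sign S * \prod_(i < d) 1)) => [|S _]; last first.
  by rewrite big1_eq.
rewrite (cube_sum (fun _ _ => 1)) -(prednK d_gt0) big_ord_recl subrr.
by rewrite mul0r.
Qed.

(** This evaluates prod_i (1 - t_i^-1) / prod_i (1 - t_i) = (-1)^d / (t_1 ... t_d),
    the source of the duality term kappa^-1 Q~. *)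
Lemma cube_sum_nonneg w : odd d ->
  \sum_S cube_sign S * (weight_le 0%R (w + cube_weight S))%:R =
  - (w == - ones d)%:R :> int.
Proof.
move=> d_odd; under eq_bigr => S _ do rewrite forall_natr.
transitivity (\prod_i ((0 <= w i + 0)%R%:R - (0 <= w i + 1)%R%:R : int)).
  rewrite -(cube_sum (fun i b => (0 <= w i + (b : nat)%:Z)%R%:R)) /=.
  by apply: eq_bigr => S _; under [in LHS]eq_bigr => i _ do rewrite !ffunE.
rewrite eq_weight_prod.
transitivity (\prod_i (- (w i == (- ones d) i)%:R) : int).
  by apply: eq_bigr => i _; rewrite !ffunE; lia.
by rewrite prodrN cardT size_enum_ord -signr_odd d_odd mulN1r.
Qed.

(** Summing over l gives the Hilbert function of I, shifted by wt j; the sum over j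
    is then an instance of [K_polynomial]. *)
Lemma Ext0_vertex w : odd d -> Ext0_virtual F w = vertex w.
Proof.
move=> d_odd; have [degD _ [DD _] _ _] := resF.
rewrite (Ext0_virtualE degD DD) ?resolution_rank ?odd_gt0 //.
transitivity (\sum_j (-1) ^+ hdeg j * (in_ideal I (wt j + w)%R)%:R
              - (weight_le 0%R w)%:R : int).
  congr (_ - _); apply: eq_bigr => j _.
  rewrite -(resolution_Euler_char idealI resF) mulr_sumr.
  by apply: eq_bigr => l _; rewrite mulrA.
rewrite (K_polynomial (fun v => (in_ideal I (v + w)%R)%:R)) add0r.
rewrite in_ideal_complement [_ - _ - _]addrAC [_ + _ - (weight_le 0%R w)%:R]addrAC subrr sub0r.
rewrite /vertex -addrA; congr (_ + _).
rewrite -sumrN -big_split; apply: eq_bigr => u _ /=.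
under eq_bigr => S _ do rewrite in_ideal_complement mulrBr addrAC.
rewrite sumrB cube_sum_nonneg // opprB opprK [LHS]addrC; congr (_ + _).
  by rewrite -[in RHS](inj_eq (addrI w)) addrA subrr add0r addrC.
by apply: eq_bigr => S _; under eq_bigr => v _ do rewrite addrAC.
Qed.
End Resolution.
End Vertex.

(** * The half vertex and its duality *)

Section HalfVertex.
Variables (d : nat) (Q : seq (expo d)) (i0 : 'I_d).
Implicit Types (S : cube d) (w : weight d).

(** Serre duality: the exponent of kappa^-1 t^(-w), kappa being the product
    of the t_i. *)
Definition dual_weight w : weight d := - w - ones d.

Lemma dual_weightK : involutive dual_weight.
Proof. by move=> w; rewrite /dual_weight opprB opprK addrC addKr. Qed.

(** The product over i <> i0 of the 1 - t_i^-1 keeps the vertices of the cube that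
    avoid i0. *)
Definition half_vertex w : int :=
  - \sum_(u <- Q) (expo_weight u == w)%:R
  + \sum_(u <- Q) \sum_(S : cube d | ~~ S i0) cube_sign S *
      \sum_(v <- Q) (expo_weight v == expo_weight u + cube_weight S + w)%:R.

Definition cube_compl S : cube d := [ffun i => ~~ S i].

Lemma cube_complK : involutive cube_compl.
Proof. by move=> S; apply/ffunP => i; rewrite !ffunE negbK. Qed.

Lemma cube_sign_compl S : odd d -> cube_sign (cube_compl S) = - cube_sign S.
Proof.
move=> d_odd; rewrite /cube_sign.
transitivity (\prod_(i < d) - ((-1) ^+ S i : int)).
  by apply: eq_bigr => i _; rewrite ffunE; case: (S i).
by rewrite prodrN cardT size_enum_ord -signr_odd d_odd mulN1r.
Qed.

Lemma cube_weight_compl S : cube_weight (cube_compl S) = ones d - cube_weight S.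
Proof. by apply/ffunP => i; rewrite !ffunE; case: (S i). Qed.

(** Splitting the factor 1 - t_i0^-1 off the product gives two halves.  The
    complement of a vertex of the cube exchanges them, together with u and v; this
    costs the sign (-1)^d = -1. *)
Lemma vertex_half w : odd d ->
  vertex Q w = half_vertex w - half_vertex (dual_weight w).
Proof.
move=> d_odd; rewrite /vertex /half_vertex opprD opprK addrACA; congr (_ + _).
rewrite -sumrN.
under eq_bigr => u _ do rewrite (bigID (fun S => S i0)) /= addrC.
rewrite big_split /=; congr (_ + _).
have reindexS u : \sum_(S : cube d | S i0) cube_sign S *
      \sum_(v <- Q) (expo_weight v == expo_weight u + cube_weight S + w)%:R =
    \sum_(v <- Q) \sum_(S : cube d | ~~ S i0) - (cube_sign S *
      (expo_weight u == expo_weight v + cube_weight S + dual_weight w)%:R).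
  rewrite exchange_big (reindex_inj (inv_inj cube_complK)) /=.
  apply: eq_big => [S|S _]; first by rewrite ffunE.
  rewrite cube_sign_compl // mulr_sumr; apply: eq_bigr => v _.
  rewrite mulNr cube_weight_compl; congr (- (_ * (nat_of_bool _)%:R)).
  have solve (a b s c : int) : (a = b + (1 - s) + c) <-> (b = a + s + (- c - 1)).
    by lia.
  apply/eqP/eqP => /ffunP uv; apply/ffunP => i; have := uv i; rewrite !ffunE.
    by move=> /solve.
  by move=> /solve.
under eq_bigr => u _ do rewrite reindexS.
rewrite exchange_big; apply: eq_bigr => v _ /=.
rewrite -sumrN exchange_big; apply: eq_bigr => S _ /=.
by rewrite mulr_sumr -sumrN.
Qed.

Lemma vertex_dual w : odd d -> vertex Q (dual_weight w) = - vertex Q w.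
Proof. by move=> d_odd; rewrite !vertex_half // dual_weightK opprB. Qed.

Lemma sum_half_cube (i1 : 'I_d) : i1 != i0 ->
  \sum_(S : cube d | ~~ S i0) cube_sign S = 0.
Proof.
move=> ne_i; rewrite big_mkcond.
transitivity (\sum_S cube_sign S * \prod_i ((i == i0) ==> ~~ S i)%:R).
  apply: eq_bigr => S _; rewrite -forall_natr.
  have -> : [forall i, (i == i0) ==> ~~ S i] = ~~ S i0.
    apply/forallP/idP => [/(_ i0)|S0 i]; first by rewrite eqxx.
    by apply/implyP => /eqP ->.
  by case: (S i0); rewrite ?mulr0 ?mulr1.
rewrite (cube_sum (fun i b => ((i == i0) ==> ~~ b)%:R)) (bigD1 i1) //=.
by rewrite (negPf ne_i) subrr mul0r.
Qed.

Definition half_vertex_weights : seq (weight d) :=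
  [seq expo_weight u | u <- Q] ++
  [seq expo_weight v - (expo_weight p.1 + cube_weight p.2)
     | v <- Q, p <- [seq (u, e) | u <- Q, e <- enum (cube d)]].

Definition vertex_weights : seq (weight d) :=
  undup (half_vertex_weights ++ map dual_weight half_vertex_weights).

Lemma vertex_weights_dual w :
  (dual_weight w \in vertex_weights) = (w \in vertex_weights).
Proof.
rewrite /vertex_weights; move: half_vertex_weights => s.
rewrite !mem_undup !mem_cat (mem_map (inv_inj dual_weightK)) orbC.
congr (_ || _).
by rewrite -[in RHS](dual_weightK w) (mem_map (inv_inj dual_weightK)).
Qed.

Lemma expo_vertex_weights u : u \in Q -> expo_weight u \in vertex_weights.
Proof. by move=> uQ; rewrite mem_undup !mem_cat map_f. Qed.

Lemma diff_vertex_weights u v S : u \in Q -> v \in Q ->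
  expo_weight v - (expo_weight u + cube_weight S) \in vertex_weights.
Proof.
move=> uQ vQ; rewrite mem_undup !mem_cat; apply/orP; left; apply/orP; right.
apply/allpairsP; exists (v, (u, S)); split=> //=.
by apply/allpairsP; exists (u, S); rewrite mem_enum.
Qed.

Lemma half_vertex_out w : w \notin vertex_weights -> half_vertex w = 0.
Proof.
move=> wX; rewrite /half_vertex big_seq big1 => [|u uQ]; last first.
  by case: eqP => // uw; rewrite -uw expo_vertex_weights in wX.
rewrite oppr0 add0r big_seq big1 // => u uQ; rewrite big1 // => S _.
rewrite big_seq big1 ?mulr0 // => v vQ; case: eqP => // uvw.
by move: wX; rewrite -[w](addKr (expo_weight u + cube_weight S)) -uvw addrC
  diff_vertex_weights.
Qed.

Lemma vertex_out w : odd d -> w \notin vertex_weights -> vertex Q w = 0.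
Proof.
move=> d_odd wX; rewrite vertex_half // !half_vertex_out ?subr0 //.
by rewrite vertex_weights_dual.
Qed.

(** At t = 1 the product over i <> i0 contains the factor of i1, which is 0, so only
    - Q survives. *)
Lemma sum_half_vertex (i1 : 'I_d) : i1 != i0 ->
  \sum_(w <- vertex_weights) half_vertex w = - (size Q)%:Z.
Proof.
move=> ne_i; rewrite big_split /= sumrN exchange_big /=.
have X_uniq : uniq vertex_weights by apply: undup_uniq.
rewrite (eq_big_seq (fun=> 1)) => [|u uQ]; last first.
  under eq_bigr => w _ do rewrite eq_sym.
  by rewrite sum_eq_mem // expo_vertex_weights.
rewrite big_const_seq count_predT iter_addr addr0 natz.
rewrite exchange_big big_seq big1 ?addr0 //= => u uQ.
rewrite exchange_big /=.
transitivity ((size Q)%:Z * \sum_(S : cube d | ~~ S i0) cube_sign S); last first.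
  by rewrite (sum_half_cube ne_i) mulr0.
rewrite mulr_sumr.
apply: eq_bigr => S _; rewrite -mulr_sumr exchange_big mulrC /=; congr (_ * _).
rewrite (eq_big_seq (fun=> 1)) => [|v vQ]; last first.
  under eq_bigr => w _ do
    rewrite -(inj_eq (addrI (- (expo_weight u + cube_weight S)))) addKr addrC eq_sym.
  by rewrite sum_eq_mem // diff_vertex_weights.
by rewrite big_const_seq count_predT iter_addr addr0 natz.
Qed.

Hypothesis Q_uniq : uniq Q.
Hypothesis Q_down : forall u v, expo_le u v -> v \in Q -> u \in Q.

(** A weight below a monomial outside the ideal is outside the ideal as soon as it
    is the exponent of a monomial at all. *)
Lemma sum_down_closed v w : v \in Q -> weight_le w (expo_weight v) ->
  \sum_(u <- Q) (expo_weight u == w)%:R = (weight_le 0%R w)%:R :> int.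
Proof.
move=> vQ wv; have [/weight_nonnegP[u wu]|w0] := boolP (weight_le 0 w).
  rewrite wu in wv *.
  under eq_bigr => u' _ do rewrite (inj_eq (@expo_weight_inj d)).
  rewrite sum_eq_mem // (Q_down _ vQ) //; apply/forallP => i.
  by move/weight_leP/(_ i): wv; rewrite !ffunE.
rewrite big1 // => u _; case: eqP => // uw.
by case/weight_nonnegP: w0; exists u.
Qed.

(** By [sum_down_closed] the sum over u only tests whether v - 1_S - c is
    nonnegative, and the sum over the cube then tests whether v = (c, ..., c): the
    result cancels the coefficient of - Q. *)
Lemma vertex_diag_nonneg (c : int) : 0 <= c -> vertex Q [ffun=> c] = 0.
Proof.
move=> c0; rewrite /vertex.
rewrite [X in _ + X + _]big1 ?addr0 => [|u _]; last first.
  case: eqP => // /ffunP/(_ i0); rewrite !ffunE => uc.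
  by exfalso; move: uc; lia.
apply/eqP; rewrite addrC subr_eq0; apply/eqP.
under eq_bigr => u _ do (under eq_bigr => S _ do rewrite mulr_sumr; rewrite exchange_big).
rewrite exchange_big /=; apply: eq_big_seq => v vQ.
rewrite exchange_big eq_sym eq_weight_cube /=; apply: eq_bigr => S _.
rewrite -mulr_sumr; congr (_ * _).
have -> : weight_le [ffun=> c] (expo_weight v - cube_weight S) =
          weight_le 0 (expo_weight v - cube_weight S - [ffun=> c]).
  by apply: eq_forallb => i; rewrite !ffunE subr_ge0.
rewrite -(sum_down_closed vQ); last first.
  apply/weight_leP => i; rewrite !ffunE -addrA gerDl; case: (S i); lia.
apply: eq_bigr => u _; congr (nat_of_bool _)%:R.
by rewrite [RHS]eq_sym !subr_eq addrAC.
Qed.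

Lemma vertex_diag (c : int) : odd d -> vertex Q [ffun=> c] = 0.
Proof.
move=> d_odd; have [c0|c0] := leP 0 c; first exact: vertex_diag_nonneg.
apply: oppr_inj; rewrite -vertex_dual // oppr0.
have -> : dual_weight [ffun=> c] = [ffun=> - c - 1].
  by apply/ffunP => i; rewrite !ffunE.
by apply: vertex_diag_nonneg; lia.
Qed.
End HalfVertex.

(** * Specialization to the hyperplane *)

Section Specialization.
Variable d : nat.
Implicit Types (p q : {mpoly rat[d]}) (f g : ratfun d).

HB.instance Definition _ := GRing.RMorphism.copy (@restrict_CY d)
  (comp_mpoly [tuple (if (i.+1 == d)%N then - \sum_(j < d | (j.+1 < d)%N) 'X_j
                 else 'X_i) | i < d]).

Lemma restrict_neq0 q : restrict_CY q != 0 -> q != 0.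
Proof. by apply: contra_neq => ->; apply: rmorph0. Qed.

Lemma specializes_tofrac p : specializes_CY (tofrac p) (tofrac (restrict_CY p)).
Proof. by exists p, 1; rewrite !rmorph1 !divr1 oner_neq0. Qed.

Lemma specializes_mpolyC c : specializes_CY (tofrac (mpolyC d c)) (tofrac (mpolyC d c)).
Proof. by have := specializes_tofrac (mpolyC d c); rewrite /restrict_CY comp_mpolyC. Qed.

Lemma specializes1 : specializes_CY (1 : ratfun d) 1.
Proof. by have := specializes_tofrac 1; rewrite !rmorph1. Qed.

Lemma specializesM f1 g1 f2 g2 : specializes_CY f1 g1 -> specializes_CY f2 g2 ->
  specializes_CY (f1 * f2) (g1 * g2).
Proof.
move=> [p1 [q1 [q1n0 -> ->]]] [p2 [q2 [q2n0 -> ->]]]; exists (p1 * p2), (q1 * q2).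
by rewrite !rmorphM mulf_neq0 //; split=> //; rewrite mulf_div.
Qed.

Lemma specializesD f1 g1 f2 g2 : specializes_CY f1 g1 -> specializes_CY f2 g2 ->
  specializes_CY (f1 + f2) (g1 + g2).
Proof.
move=> [p1 [q1 [q1n0 -> ->]]] [p2 [q2 [q2n0 -> ->]]].
exists (p1 * q2 + p2 * q1), (q1 * q2).
have := restrict_neq0 q1n0; have := restrict_neq0 q2n0 => q2'n0 q1'n0.
rewrite !rmorphD !rmorphM mulf_neq0 //.
by split=> //; rewrite addf_div ?tofrac_eq0.
Qed.

Lemma specializesV p : restrict_CY p != 0 ->
  specializes_CY (tofrac p)^-1 (tofrac (restrict_CY p))^-1.
Proof. by move=> pn0; exists 1, p; rewrite !rmorph1 !div1r. Qed.

Lemma specializes_exprz p (n : int) : restrict_CY p != 0 ->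
  specializes_CY (tofrac p ^ n) (tofrac (restrict_CY p) ^ n).
Proof.
move=> pn0; case: n => n; last rewrite NegzE -!invr_expz.
  by rewrite -!exprnP -!rmorphXn; apply: specializes_tofrac.
rewrite -!exprnP -!tofracXn -[restrict_CY p ^+ _]rmorphXn; apply: specializesV.
by rewrite rmorphXn expf_neq0.
Qed.

Lemma specializes_prod (T : eqType) (s : seq T) (F G : T -> ratfun d) :
    (forall x, x \in s -> specializes_CY (F x) (G x)) ->
  specializes_CY (\prod_(x <- s) F x) (\prod_(x <- s) G x).
Proof.
elim: s => [|x s IH] FG; first by rewrite !big_nil; apply: specializes1.
rewrite !big_cons; apply: specializesM; first by apply: FG; rewrite mem_head.
by apply: IH => y ys; apply: FG; rewrite inE ys orbT.
Qed.

Lemma specializes_sum (T : eqType) (s : seq T) (F G : T -> ratfun d) :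
    (forall x, x \in s -> specializes_CY (F x) (G x)) ->
  specializes_CY (\sum_(x <- s) F x) (\sum_(x <- s) G x).
Proof.
elim: s => [|x s IH] FG.
  by rewrite !big_nil; have := specializes_mpolyC 0; rewrite !rmorph0.
rewrite !big_cons; apply: specializesD; first by apply: FG; rewrite mem_head.
by apply: IH => y ys; apply: FG; rewrite inE ys orbT.
Qed.

End Specialization.

(** Only the differences of the coordinates of w matter, because the form of
    (1, ..., 1) becomes 0. *)
Lemma restrict_linear_form k (w : weight k.+1) :
  restrict_CY (linear_form w) = \sum_i (w i - w ord_max)%:~R *: 'X_i.
Proof.
rewrite rmorph_sum /=.
have restrictX (i : 'I_k.+1) : restrict_CY 'X_i =
    if i == ord_max then - \sum_(j < k.+1 | j != ord_max) 'X_j else 'X_i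
    :> {mpoly rat[k.+1]}.
  rewrite /restrict_CY comp_mpolyXU nth_mktuple eqSS -val_eqE /=.
  case: ifP => // _; congr (- _); apply: eq_bigl => j.
  by rewrite ltnS ltn_neqAle -val_eqE /= -ltnS ltn_ord andbT.
rewrite (eq_bigr (fun i => (w i)%:~R *: restrict_CY 'X_i)) => [|i _]; last first.
  by rewrite /restrict_CY comp_mpolyZ.
rewrite (bigD1 ord_max) //= restrictX eqxx.
rewrite [RHS](bigD1 ord_max) //= subrr scale0r add0r.
rewrite scalerN scaler_sumr -sumrN -big_split /=; apply: eq_bigr => i /negPf ne_i.
by rewrite restrictX ne_i rmorphB scalerBl addrC.
Qed.

Lemma restrict_linear_form_eq0 k (w : weight k.+1) :
  restrict_CY (linear_form w) = 0 -> w = [ffun=> w ord_max].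
Proof.
rewrite restrict_linear_form => /mpolyP w0; apply/ffunP => i; rewrite ffunE.
have := w0 U_(i)%MM; rewrite raddf_sum mcoeff0 (bigD1 i) //= big1 => [|j ne_j].
  by rewrite mcoeffZ mcoeffX eqxx mulr1 addr0 => /eqP; rewrite intr_eq0 subr_eq0 => /eqP.
by rewrite mcoeffZ mcoeffX eq_mnm1 (negPf ne_j) mulr0.
Qed.

Lemma restrict_linear_form_dual k (w : weight k.+1) :
  restrict_CY (linear_form (dual_weight w)) = - restrict_CY (linear_form w).
Proof.
rewrite !restrict_linear_form -sumrN; apply: eq_bigr => i _.
by rewrite -scaleNr -rmorphN !ffunE; congr (_%:~R *: _); ring.
Qed.

(** Reindexing the factors with exponent - W (s x) along s turns the product into
    that of the (r x / r (s x)) ^ W x, all of them signs. *)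
Lemma prod_antisymmetric (L : fieldType) (T : eqType) (X : seq T) (s : T -> T)
    (r : T -> L) (W : T -> int) :
    uniq X -> involutive s -> (forall x, (s x \in X) = (x \in X)) ->
    (forall x, r x != 0) -> (forall x, r (s x) = - r x) ->
  \prod_(x <- X) r x ^ (W x - W (s x)) = (-1) ^ (\sum_(x <- X) W x).
Proof.
move=> X_uniq sK Xs r0 rs.
under eq_bigr => x _ do rewrite expfzDr //.
rewrite big_split /= [X in _ * X](perm_big (map s X)) /=; last first.
  apply: uniq_perm; rewrite ?(map_inj_uniq (inv_inj sK)) // => x.
  by rewrite -[x in RHS]sK (mem_map (inv_inj sK)) Xs.
rewrite big_map -big_split /= (eq_bigr (fun x => (-1) ^ W x)) => [|x _].
  by elim: X {X_uniq Xs} => [|x X IH]; rewrite ?big_nil ?expr0z // !big_cons IH expfzDr ?oppr_eq0 ?oner_neq0.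
rewrite sK rs expNrz mulrCA -expfzDr // subrr expr0z mulr1.
by rewrite -exprz_inv invrN1.
Qed.

(** * The contribution of one fixed point *)

Section EulerVertex.
Variables (k : nat) (Q : seq (expo k.+1)) (V : weight k.+1 -> int).
Hypotheses (d_odd : odd k.+1) (Q_uniq : uniq Q).
Hypothesis Q_down : forall u v, expo_le u v -> v \in Q -> u \in Q.
Hypothesis VE : V =1 vertex Q.
Local Notation X := (vertex_weights Q).

Lemma has_euler_vertex : has_euler V.
Proof.
split; last first.
  have -> : 0 = [ffun=> 0] :> weight k.+1 by apply/ffunP => i; rewrite !ffunE.
  by rewrite VE vertex_diag //; exact: ord0.
apply: (@sub_finite_set _ _ [set` X]); last exact: finite_seq.
move=> w /=; rewrite VE; apply: contraNT => wX.
by rewrite (vertex_out ord0).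
Qed.

(** The restricted linear forms, altered on the weights (c, ..., c), where they are
    0: any nonzero values that are antisymmetric under [dual_weight], which maps c
    to - c - 1, allow [prod_antisymmetric] to be applied to all weights at once,
    and these weights have exponent 0. *)
Definition restricted_form (w : weight k.+1) : ratfun k.+1 :=
  if w == [ffun=> w ord_max] then (if 0 <= w ord_max then 1 else -1)
  else tofrac (restrict_CY (linear_form w)).

Lemma restricted_form_neq0 w : restricted_form w != 0.
Proof.
rewrite /restricted_form; case: ifPn => [_|ne_w].
  by case: ifP => _; rewrite ?oppr_eq0 oner_neq0.
by rewrite tofrac_eq0; apply: contra_neq ne_w => /restrict_linear_form_eq0.
Qed.

Lemma restricted_form_dual w : restricted_form (dual_weight w) = - restricted_form w.
Proof.
rewrite /restricted_form restrict_linear_form_dual rmorphN.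
have -> : (dual_weight w == [ffun=> dual_weight w ord_max]) = (w == [ffun=> w ord_max]).
  apply/eqP/eqP => /ffunP ew; apply/ffunP => i; have := ew i; rewrite !ffunE.
    by move=> /addIr /oppr_inj.
  by move=> ->.
case: ifP => // _; rewrite !ffunE.
have -> : (0 <= - w ord_max - 1) = ~~ (0 <= w ord_max).
  by move: (w ord_max) => c; lia.
by case: (0 <= w ord_max); rewrite ?opprK.
Qed.

Lemma specializes_euler_vertex : (1 < k.+1)%N ->
  specializes_CY (euler V) ((-1) ^+ size Q).
Proof.
move=> k_gt1.
have X_uniq : uniq X by apply: undup_uniq.
have -> : euler V = \prod_(w <- X) tofrac (linear_form w) ^ vertex Q w.
  rewrite /euler (fsbigE X) //; last first.
    by move=> w _ wX; rewrite VE (vertex_out ord0) ?expr0z.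
  apply: eq_big => [w|w _]; last by rewrite VE.
  by apply/mem_set.
have -> : (-1) ^+ size Q = \prod_(w <- X) restricted_form w ^ vertex Q w.
  under eq_bigr => w _ do rewrite (vertex_half Q ord_max) //.
  rewrite prod_antisymmetric //.
  - rewrite (@sum_half_vertex _ _ _ ord0) //; last by rewrite -val_eqE /= eq_sym -lt0n -ltnS.
    by rewrite -exprz_inv invrN1.
  - exact: dual_weightK.
  - exact: vertex_weights_dual.
  - exact: restricted_form_neq0.
  - exact: restricted_form_dual.
apply: specializes_prod => w _; rewrite /restricted_form; case: ifPn => [/eqP->|ne_w].
  by rewrite vertex_diag ?expr0z //; [exact: specializes1|exact: ord0].
apply: specializes_exprz; apply: contra_neq ne_w.
exact: restrict_linear_form_eq0.
Qed.
End EulerVertex.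

(** * Fixed points and partitions *)

Lemma card_set_seq (T : choiceType) (s : seq T) :
  uniq s -> ([set` s] #= `I_(size s))%card.
Proof.
move=> s_uniq; have -> : [set` s] = [set` [fset x in s]%fset].
  by apply/seteqP; split=> x /=; rewrite inE.
by apply/card_eq_fsetP; rewrite card_fseq undup_id.
Qed.

Lemma Hilb_complement d n (I : set (expo d)) : Hilb_fixed d n I ->
  exists Q : seq (expo d), [/\ uniq Q, size Q = n, forall u, u \in Q <-> ~ I u
    & forall u v, expo_le u v -> v \in Q -> u \in Q].
Proof.
move=> [idealI cardI].
have fin : finite_set (~` I) by apply/finite_setP; exists n.
have memQ u : u \in fset_set (~` I) <-> ~ I u.
  by rewrite in_fset_set // in_setE.
exists (fset_set (~` I)); split=> //; [exact: fset_uniq|exact: card_fset_set|].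
by move=> u v uv /memQ nIv; apply/memQ => Iu; apply: nIv; apply: idealI Iu.
Qed.

Section Stacking.
Variable k : nat.
Implicit Types (u : expo k) (v : expo k.+1) (p : expo k -> nat).

Definition stack u (m : nat) : expo k.+1 :=
  [ffun i => if unlift ord_max i is Some j then u j else m].
Definition base v : expo k := [ffun j => v (lift ord_max j)].

Lemma base_stack u m : base (stack u m) = u.
Proof. by apply/ffunP => j; rewrite !ffunE liftK. Qed.

Lemma stack_max u m : stack u m ord_max = m.
Proof. by rewrite ffunE unlift_none. Qed.

Lemma stack_base v : stack (base v) (v ord_max) = v.
Proof. by apply/ffunP => i; rewrite ffunE; case: unliftP => [j|] ->; rewrite ?ffunE. Qed.

Lemma base_le v v' : expo_le v v' -> expo_le (base v) (base v').
Proof. by move=> /forallP vv'; apply/forallP => j; rewrite !ffunE. Qed.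

Lemma stack_le u u' m m' : expo_le u u' -> (m <= m')%N ->
  expo_le (stack u m) (stack u' m').
Proof.
move=> /forallP uu' mm'; apply/forallP => i; rewrite !ffunE.
by case: unliftP.
Qed.

(** The monomials outside the ideal are the boxes of the stacks of height p u over
    the points u. *)
Definition partition_ideal p : set (expo k.+1) := [set v | (p (base v) <= v ord_max)%N].

Lemma partition_ideal_inj : injective partition_ideal.
Proof.
move=> p p' eq_pp'; apply: funext => u.
have eq_le m : (p u <= m)%N = (p' u <= m)%N.
  have : partition_ideal p (stack u m) = partition_ideal p' (stack u m) by rewrite eq_pp'.
  by rewrite /partition_ideal /= base_stack stack_max => /is_true_inj.
by apply/eqP; rewrite eqn_leq eq_le leqnn -eq_le leqnn.
Qed.

Lemma monomial_partition_ideal p : is_partition p -> monomial_ideal (partition_ideal p).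
Proof.
move=> [anti_p _] v v' vv' /= le_v; apply: leq_trans (forallP vv' ord_max).
by apply: leq_trans le_v; apply: anti_p; apply: base_le.
Qed.

Definition boxes p : seq (expo k.+1) :=
  [seq stack u m | u <- finite_support 0%N [set: expo k] p, m <- iota 0 (p u)].

Lemma mem_boxes p v : is_partition p -> v \in boxes p <-> ~ partition_ideal p v.
Proof.
move=> [_ fin_p]; rewrite /partition_ideal /=.
have memS u : u \in finite_support 0%N [set: expo k] p = (p u != 0%N).
  rewrite in_finite_support; last first.
    by apply: sub_finite_set fin_p => u' /= [_ /eqP].
  apply/idP/idP => [|pu]; first by rewrite in_setE => -[_ /eqP].
  by rewrite in_setE; split=> //; apply/eqP.
split=> [/allpairsPdep[u [m [_ mi ->]]]|/negP].
  rewrite base_stack stack_max; apply/negP; rewrite -ltnNge.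
  by move: mi; rewrite mem_iota.
rewrite -ltnNge => lt_v; apply/allpairsPdep; exists (base v), (v ord_max).
by rewrite memS mem_iota add0n lt_v stack_base -lt0n (leq_ltn_trans _ lt_v).
Qed.

Lemma uniq_boxes p : uniq (boxes p).
Proof.
apply: allpairs_uniq_dep => [|u _|]; rewrite ?iota_uniq ?finite_support_uniq //.
move=> [u m] [u' m'] _ _ /= eq_s.
have := congr1 base eq_s; rewrite !base_stack => uu'.
by have := congr1 (fun v : expo k.+1 => v ord_max) eq_s; rewrite !stack_max uu' => ->.
Qed.

Lemma size_boxes p : size (boxes p) = partition_size p.
Proof.
rewrite size_allpairs_dep sumnE big_map.
by under eq_bigr => u _ do rewrite size_iota.
Qed.

Lemma Hilb_partition_ideal p n : is_partition p ->
  Hilb_fixed k.+1 n (partition_ideal p) <-> partition_size p = n.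
Proof.
move=> part_p.
have -> : (Hilb_fixed k.+1 n (partition_ideal p)) =
          (~` partition_ideal p #= `I_n)%card :> Prop.
  by apply/propext; split=> [[]//|cardp]; split=> //; apply: monomial_partition_ideal.
have -> : ~` partition_ideal p = [set` boxes p].
  by apply/seteqP; split=> v /= /(mem_boxes v part_p).
rewrite (card_eql (card_set_seq (uniq_boxes p))) size_boxes.
by split=> [/card_eq_II|->]; last exact: card_eqxx.
Qed.

(** The height of the stack over u is the least m with (u, m) in the ideal; it exists
    since finitely many monomials lie outside. *)
Lemma ideal_is_partition_ideal n (I : set (expo k.+1)) : Hilb_fixed k.+1 n I ->
  exists2 p, is_partition p & I = partition_ideal p.
Proof.
move=> HI; have [idealI _] := HI; have [Q [_ _ memQ _]] := Hilb_complement HI.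
have memQN v : v \notin Q <-> I v.
  by split=> [vQ|Iv]; [apply: contrapT => /memQ; rewrite (negPf vQ)|apply/negP => /memQ].
have exI u : exists m, stack u m \notin Q.
  exists (\max_(v <- Q) v ord_max).+1; apply/negP => uQ.
  have := @leq_bigmax_seq _ Q xpredT (fun v : expo k.+1 => v ord_max) _ uQ isT.
  by rewrite stack_max ltnn.
pose p u := ex_minn (exI u).
have pI u : I (stack u (p u)) by rewrite /p; case: ex_minnP => m /memQN.
have p_min u m : I (stack u m) -> (p u <= m)%N.
  by rewrite /p; case: ex_minnP => m' _ min_m' /memQN /min_m'.
exists p.
  split=> [u u' uu'|]; first by apply: p_min; apply: idealI (pI u); apply: stack_le.
  apply: (@sub_finite_set _ _ [set` map base Q]); last exact: finite_seq.
  move=> u /=; rewrite -lt0n => pu; apply/mapP; exists (stack u 0); last by rewrite base_stack.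
  by apply/negPn/negP => /memQN /p_min; rewrite leqNgt pu.
apply/seteqP; split=> v.
  by move=> Iv; apply: p_min; rewrite stack_base.
by move=> le_v; rewrite -(stack_base v); apply: idealI (pI (base v)); apply: stack_le => //;
  apply/forallP.
Qed.

Lemma Hilb_fixed_partitions n :
  Hilb_fixed k.+1 n =
  partition_ideal @` [set p : expo k -> nat | is_partition p /\ partition_size p = n].
Proof.
apply/seteqP; split=> [I HI|_ [p [part_p size_p] <-]]; last exact/Hilb_partition_ideal.
have [p part_p IE] := ideal_is_partition_ideal HI; exists p => //; split=> //.
by apply/Hilb_partition_ideal; rewrite -?IE.
Qed.

End Stacking.

(** A monomial outside I has exponents below n: lowering one coordinate of u to any
    smaller value stays outside I, and gives more than u i monomials. *)
Lemma Hilb_fixed_finite d n : finite_set (Hilb_fixed d n).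
Proof.
pose ideal_of (A : {set {ffun 'I_d -> 'I_n}}) : set (expo d) :=
  [set v | ~ exists2 x, x \in A & v = [ffun i => x i : nat]].
apply: (@sub_finite_set _ _ (ideal_of @` [set: {set {ffun 'I_d -> 'I_n}}])); last first.
  exact/finite_image/finite_finset.
move=> I /Hilb_complement[Q [Q_uniq sizeQ memQ Q_down]].
have ltQ u i : u \in Q -> (u i < n)%N.
  move=> uQ; pose lower m : expo d := [ffun j => if j == i then m else u j].
  have lower_inj : injective lower.
    by move=> m m' /ffunP/(_ i); rewrite !ffunE eqxx.
  rewrite -sizeQ -[(u i).+1](size_iota 0) -(size_map lower); apply: uniq_leq_size.
    by rewrite map_inj_uniq ?iota_uniq.
  move=> x /mapP[m]; rewrite mem_iota => /andP[_ le_m] ->.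
  apply: (Q_down _ u _ uQ); apply/forallP => j; rewrite ffunE.
  by case: eqP => // ->.
exists [set x : {ffun 'I_d -> 'I_n} | [ffun i => x i : nat] \in Q]%SET => //.
apply/seteqP; split=> v /=.
  move=> nex; apply: contrapT => /memQ vQ; apply: nex.
  exists [ffun i => Ordinal (ltQ v i vQ)]; last by apply/ffunP => i; rewrite !ffunE.
  rewrite inE; suff -> : [ffun i => [ffun i => Ordinal (ltQ v i vQ)] i : nat] = v by [].
  by apply/ffunP => i; rewrite !ffunE.
by move=> Iv [x]; rewrite inE => /memQ xQ vx; apply: xQ; rewrite -vx.
Qed.

Lemma card_Hilb_fixed k n : #|` fset_set (Hilb_fixed k.+1 n)|%:R = M_series k n.
Proof.
have cardE A := @inj_card_eq _ _ A _ (in2W (@partition_ideal_inj k)).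
rewrite /M_series Hilb_fixed_partitions; congr _%:R.
have fin := Hilb_fixed_finite k.+1 n; rewrite Hilb_fixed_partitions in fin.
have fin' := fin; rewrite (eq_finite_set (cardE _)) in fin'.
exact/(fcard_eq fin fin')/cardE.
Qed.

(** * The generating series *)

Lemma M_series0 k : M_series k 0 = 1.
Proof.
rewrite -card_Hilb_fixed; suff -> : Hilb_fixed k.+1 0 = [set setT].
  by rewrite fset_set1 cardfs1.
apply/seteqP; split=> [I [_]|_ ->] /=.
  by rewrite II0 card_eq0 => /eqP/(congr1 setC); rewrite setCK setC0.
by split=> //; rewrite setCT II0.
Qed.

(** Every fixed point contributes (-1)^n. *)
Theorem theorem1p3 (R : realType) (d : nat) (d_odd : odd d) (d_ge3 : (3 <= d)%N)
    (F : set (expo d) -> free_complex (complex R) d)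
    (F_resolves : forall (n : nat) (I : set (expo d)),
        Hilb_fixed d n I -> resolves (F I) I) :
  (forall (n : nat) (I : set (expo d)), (1 <= n)%N -> Hilb_fixed d n I ->
      has_euler (Ext0_virtual (F I))) /\
  (forall n : nat,
      specializes_CY (Z_series F n)
        (tofrac (mpolyC d (subst_opp_q (M_series d.-1) n)))).
Proof.
case: d d_odd d_ge3 F F_resolves => // k d_odd d_ge3 F F_resolves.
have vertexE n I : Hilb_fixed k.+1 n I -> exists Q, [/\ uniq Q, size Q = n,
    forall u v, expo_le u v -> v \in Q -> u \in Q
    & Ext0_virtual (F I) =1 vertex Q].
  move=> HI; have [idealI _] := HI.
  have [Q [Q_uniq sizeQ memQ Q_down]] := Hilb_complement HI.
  by exists Q; split=> // w; apply: (Ext0_vertex idealI (F_resolves n I HI)).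
split=> [n I _ /vertexE[Q [Q_uniq _ Q_down VE]]|n].
  exact: (has_euler_vertex d_odd Q_uniq Q_down VE).
have Z_spec m : specializes_CY (Z_inv F m)
    (tofrac (mpolyC k.+1 (subst_opp_q (M_series k) m))).
  have finH := Hilb_fixed_finite k.+1 m.
  have memH I : (I \in fset_set (Hilb_fixed k.+1 m)) = (I \in Hilb_fixed k.+1 m).
    by rewrite in_fset_set.
  have subH : [set` fset_set (Hilb_fixed k.+1 m)] `<=` Hilb_fixed k.+1 m.
    by move=> I /=; rewrite memH => /set_mem.
  rewrite /Z_inv (fsbigE _ _ (fset_uniq _) subH); last first.
    by move=> I HI; rewrite memH mem_set.
  rewrite big_seq_cond (eq_bigl (fun I => I \in fset_set (Hilb_fixed k.+1 m))); last first.
    by move=> I; rewrite memH andbb.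
  rewrite -big_seq.
  have -> : tofrac (mpolyC k.+1 (subst_opp_q (M_series k) m)) =
      \sum_(I <- fset_set (Hilb_fixed k.+1 m)) (-1) ^+ m.
    rewrite big_const_seq count_predT iter_addr addr0 /subst_opp_q -card_Hilb_fixed.
    rewrite -mulr_natr !rmorphM !rmorphXn !rmorphN1 !rmorph1 !rmorph_nat.
    by rewrite mul1r mulr_natr.
  apply: specializes_sum => I; rewrite memH => /set_mem.
  move=> /vertexE[Q [Q_uniq <- Q_down VE]].
  by apply: (specializes_euler_vertex d_odd Q_uniq Q_down VE); apply: leq_trans d_ge3.
case: n => [|n]; last exact: Z_spec.
have -> : subst_opp_q (M_series k) 0 = 1.
  by rewrite /subst_opp_q expr0 mul1r M_series0.
by rewrite mpolyC1 tofrac1; apply: specializes1.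
Qed.
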